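(* Let $N,L$ be positive integers, let $T_q(N,L)$ be the algebra with generators $\tau(x,y)$, $x,y\in\mathbb Z$, and $\tilde\kappa=\tilde\kappa_+\circ\tilde\kappa_-$ the automorphism described in the context. For integers $t,x,y$ with $t+x+y$ even define $\tau(t,x,y)$ by $$\tau(2t,x,y)=\tilde\kappa^t(\tau(x,y))\ \text{ if } x+y\text{ is even},\qquad \tau(2t-1,x,y)=\tilde\kappa^t(\tau(x,y))\ \text{ if } x+y\text{ is odd}\qquad(t\in\mathbb Z).$$ Then the operators $\tau(t,x,y)$ satisfy the equations $$\tau(t+1,x,y)\tau(t-1,x,y)+\tau(t,x+1,y)\tau(t,x-1,y)+\tau(t,x,y+1)\tau(t,x,y-1)=0$$ for all integers $t,x,y$ with $t+x+y$ odd, and the permutation relations $$\tau(t,x,y)\tau(t-1,x',y')=q^{G(x-x',y-y')}\tau(t-1,x',y')\tau(t,x,y),$$ $$\tau(t,x,y)\tau(t,x',y')=\tau(t,x',y')\tau(t,x,y)$$ whenever the operators involved are defined.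
   Context: For a positive integer $m$ and an integer $n$, $[n]_m\in\{0,\dots,m-1\}$ is the residue of $n$ modulo $m$ and $\varepsilon_m(n)=\frac{m-1-2[n]_m}{m}$. Let $F=\gcd(L,N)$, $J=LN/F$, $q\ne0$ a complex number with a fixed logarithm $h=\ln q$, and $q^s=e^{hs}$. For integers $x,y$ with $x+y$ odd, $$G(x,y)=\frac12\sum_{j=1}^{N/F}\left(\frac{x-y}{J}+\varepsilon_J\!\left(\frac{x-y-1}{2}+jL\right)\right)\left(\frac{x+y}{N}+\varepsilon_N\!\left(\frac{x+y-1}{2}+jL\right)\right).$$ $T_q(N,L)$ is the algebra generated by invertible elements $\tau(x,y)$, $x,y\in\mathbb Z$, with relations: $\tau(x,y)\tau(x',y')=\tau(x',y')\tau(x,y)$ if $x+y$ and $x'+y'$ have the same parity, and $\tau(x,y)\tau(x',y')=q^{G(x-x',y-y')}\tau(x',y')\tau(x,y)$ if $x+y$ is even and $x'+y'$ is odd; in addition, with $\eta(x,y)=(\tau(x-1,y)\tau(x+1,y))^{-1}\tau(x,y-1)\tau(x,y+1)$, the periodicity conditions $\eta(x+2L,y)=\eta(x+N,y+N)=\eta(x,y)$ are imposed for all $x,y$. The maps $\tilde\kappa_\pm$ are the commuting automorphisms of (a completion of, e.g. the division ring of fractions of) $T_q(N,L)$ given on generators by $$\tilde\kappa_\pm(\tau(x\mp1,y))=\tau(x,y)\quad(x+y\text{ even}),$$ $$\tilde\kappa_\pm(\tau(x\mp1,y))=-\bigl(\tau(x+1,y)\tau(x-1,y)+\tau(x,y+1)\tau(x,y-1)\bigr)\tau^{-1}(x,y)\quad(x+y\text{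 odd}).$$ *)

(* Defs.v *)
From HB Require Import structures.
From mathcomp Require Import all_boot all_order all_algebra.
From mathcomp Require Import complex.
From mathcomp Require Import boolp reals topology normedtype sequences exp trigo.
From mathcomp Require Import ring zify.

Set Implicit Arguments.
Unset Strict Implicit.
Unset Printing Implicit Defensive.

Import Order.TTheory GRing.Theory Num.Theory.
Local Open Scope ring_scope.
Local Open Scope complex_scope.
Local Open Scope quotient_scope.

Section ComplexPower.
Variable R : realType.
Implicit Types z w h : R[i].

Definition cexp z : R[i] :=
  let: a +i* b := z in (expR a)%:C * (cos b +i* sin b).

(* q ^ s = exp (h s), where h is the chosen logarithm of q *)
Definition qpow h (s : rat) : R[i] := cexp (h * ratr s).

Lemma cexpD z w : cexp (z + w) = cexp z * cexp w.
Proof.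
case: z => a b; case: w => c d; rewrite /cexp /= expRD cosD sinD.
by apply/eqP; rewrite eq_complex /=; apply/andP; split; apply/eqP; ring.
Qed.

Lemma cexp0 : cexp 0 = 1.
Proof.
rewrite /cexp /= expR0 cos0 sin0.
by apply/eqP; rewrite eq_complex /=; apply/andP; split; apply/eqP; ring.
Qed.

Lemma cexpN z : cexp z * cexp (- z) = 1.
Proof. by rewrite -cexpD subrr cexp0. Qed.

End ComplexPower.

Section GFunction.
Variables N L : nat.

Definition eps (m : nat) (n : int) : rat :=
  (m%:R - 1 - 2 * ((n %% m)%Z)%:~R) / m%:R.

Definition Fgcd : nat := gcdn L N.
Definition Jlcm : nat := (L * N %/ Fgcd)%N.

(* Only meaningful for x + y odd, when both halves are exact. *)
Definition G (x y : int) : rat :=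
  2^-1 * \sum_(1 <= j < (N %/ Fgcd).+1)
    (((x - y)%:~R / Jlcm%:R + eps Jlcm (((x - y - 1) %/ 2)%Z + (j * L)%N)) *
     ((x + y)%:~R / N%:R + eps N (((x + y - 1) %/ 2)%Z + (j * L)%N))).

End GFunction.

Section Algebra.
Variables (R : realType) (N L : nat) (h : R[i]).

(* Formal expressions in the generators and their inverses; the algebra is
   their quotient by the least congruence [teq] that contains the axioms of
   unital associative R[i]-algebras and the defining relations. *)
Inductive term : Type :=
| Gen of int & int
| GenV of int & int
| Scal of R[i]
| Add of term & term
| Mul of term & term.

(* (tau(x-1,y) tau(x+1,y))^-1 tau(x,y-1) tau(x,y+1) *)
Definition eta_term (x y : int) : term :=
  Mul (Mul (GenV (x + 1) y) (GenV (x - 1) y)) (Mul (Gen x (y - 1)) (Gen x (y + 1))).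

Inductive teq : term -> term -> Prop :=
| teq_refl a : teq a a
| teq_sym a b : teq a b -> teq b a
| teq_trans a b c : teq a b -> teq b c -> teq a c
| teq_add a a' b b' : teq a a' -> teq b b' -> teq (Add a b) (Add a' b')
| teq_mul a a' b b' : teq a a' -> teq b b' -> teq (Mul a b) (Mul a' b')
| teq_addA a b c : teq (Add a (Add b c)) (Add (Add a b) c)
| teq_addC a b : teq (Add a b) (Add b a)
| teq_add0 a : teq (Add (Scal 0) a) a
| teq_addN a : teq (Add (Mul (Scal (-1)) a) a) (Scal 0)
| teq_mulA a b c : teq (Mul a (Mul b c)) (Mul (Mul a b) c)
| teq_mul1 a : teq (Mul (Scal 1) a) a
| teq_mulDl a b c : teq (Mul (Add a b) c) (Add (Mul a c) (Mul b c))
| teq_mulDr a b c : teq (Mul a (Add b c)) (Add (Mul a b) (Mul a c))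
| teq_scalD k l : teq (Scal (k + l)) (Add (Scal k) (Scal l))
| teq_scalM k l : teq (Scal (k * l)) (Mul (Scal k) (Scal l))
| teq_scalC k a : teq (Mul (Scal k) a) (Mul a (Scal k))
| teq_genV (x y : int) : teq (Mul (Gen x y) (GenV x y)) (Scal 1)
| teq_Vgen (x y : int) : teq (Mul (GenV x y) (Gen x y)) (Scal 1)
| teq_comm (x y x' y' : int) :
    (2 %| x + y)%Z = (2 %| x' + y')%Z ->
    teq (Mul (Gen x y) (Gen x' y')) (Mul (Gen x' y') (Gen x y))
| teq_qcomm (x y x' y' : int) :
    (2 %| x + y)%Z -> ~~ (2 %| x' + y')%Z ->
    teq (Mul (Gen x y) (Gen x' y'))
        (Mul (Scal (qpow h (G N L (x - x') (y - y')))) (Mul (Gen x' y') (Gen x y)))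
| teq_eta2L (x y : int) : teq (eta_term (x + (2 * L)%N%:Z) y) (eta_term x y)
| teq_etaN (x y : int) : teq (eta_term (x + N%:Z) (y + N%:Z)) (eta_term x y).

HB.instance Definition _ := gen_eqMixin term.
HB.instance Definition _ := gen_choiceMixin term.

Definition teqb (a b : term) : bool := `[< teq a b >].

Lemma teqb_refl : reflexive teqb.
Proof. by move=> a; apply/asboolP; exact: teq_refl. Qed.

Lemma teqb_sym : symmetric teqb.
Proof.
by move=> a b; apply/asboolP/asboolP; exact: teq_sym.
Qed.

Lemma teqb_trans : transitive teqb.
Proof.
by move=> b a c /asboolP ab /asboolP bc; apply/asboolP; exact: teq_trans ab bc.
Qed.

Canonical teq_equiv := EquivRel teqb teqb_refl teqb_sym teqb_trans.

Definition Tq : Type := {eq_quot teq_equiv}.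

HB.instance Definition _ := Choice.on Tq.

Definition cls (a : term) : Tq := \pi_({eq_quot teq_equiv}) a.
Definition rep (u : Tq) : term := repr (u : {eq_quot teq_equiv}).

Lemma clsP a b : cls a = cls b <-> teq a b.
Proof.
split; first by move=> /eqmodP/asboolP.
by move=> ab; apply/eqmodP/asboolP.
Qed.

Lemma repK u : cls (rep u) = u.
Proof. exact: reprK. Qed.

Lemma rep_cls a : teq (rep (cls a)) a.
Proof. by apply/clsP; rewrite repK. Qed.

Definition Tadd u v := cls (Add (rep u) (rep v)).
Definition Tmul u v := cls (Mul (rep u) (rep v)).
Definition Topp u := cls (Mul (Scal (-1)) (rep u)).
Definition Tscale k u := cls (Mul (Scal k) (rep u)).

Lemma TaddE a b : Tadd (cls a) (cls b) = cls (Add a b).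
Proof. by apply/clsP; apply: teq_add; exact: rep_cls. Qed.

Lemma TmulE a b : Tmul (cls a) (cls b) = cls (Mul a b).
Proof. by apply/clsP; apply: teq_mul; exact: rep_cls. Qed.

Lemma ToppE a : Topp (cls a) = cls (Mul (Scal (-1)) a).
Proof. by apply/clsP/teq_mul; [exact: teq_refl|exact: rep_cls]. Qed.

Lemma TscaleE k a : Tscale k (cls a) = cls (Mul (Scal k) a).
Proof. by apply/clsP/teq_mul; [exact: teq_refl|exact: rep_cls]. Qed.

Lemma TaddA : associative Tadd.
Proof.
move=> u v w; rewrite -(repK u) -(repK v) -(repK w) !TaddE.
by apply/clsP; exact: teq_addA.
Qed.

Lemma TaddC : commutative Tadd.
Proof.
by move=> u v; rewrite -(repK u) -(repK v) !TaddE; apply/clsP; exact: teq_addC.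
Qed.

Lemma Tadd0 : left_id (cls (Scal 0)) Tadd.
Proof. by move=> u; rewrite -(repK u) TaddE; apply/clsP; exact: teq_add0. Qed.

Lemma TaddN : left_inverse (cls (Scal 0)) Topp Tadd.
Proof.
by move=> u; rewrite -(repK u) ToppE TaddE; apply/clsP; exact: teq_addN.
Qed.

HB.instance Definition _ := GRing.isZmodule.Build Tq TaddA TaddC Tadd0 TaddN.

Lemma TmulA : associative Tmul.
Proof.
move=> u v w; rewrite -(repK u) -(repK v) -(repK w) !TmulE.
by apply/clsP; exact: teq_mulA.
Qed.

Lemma Tmul1 : left_id (cls (Scal 1)) Tmul.
Proof. by move=> u; rewrite -(repK u) TmulE; apply/clsP; exact: teq_mul1. Qed.

Lemma Tmulr1 : right_id (cls (Scal 1)) Tmul.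
Proof.
move=> u; rewrite -(repK u) TmulE; apply/clsP.
exact: teq_trans (teq_sym (teq_scalC _ _)) (teq_mul1 _).
Qed.

Lemma TmulDl : left_distributive Tmul Tadd.
Proof.
move=> u v w; rewrite -(repK u) -(repK v) -(repK w) !(TaddE, TmulE).
by apply/clsP; exact: teq_mulDl.
Qed.

Lemma TmulDr : right_distributive Tmul Tadd.
Proof.
move=> u v w; rewrite -(repK u) -(repK v) -(repK w) !(TaddE, TmulE).
by apply/clsP; exact: teq_mulDr.
Qed.

(* The algebra is nonzero: it acts on the functions of s : int -> int -> R[i]
   whose second difference has the two periods, the even generators by
   translation of s and the odd ones by multiplication by exp (h s(x, y)). *)
Section Nontrivial.

Let laplace (V : zmodType) (f : int -> int -> V) (x y : int) : V :=
  f x (y - 1) + f x (y + 1) - f (x - 1) y - f (x + 1) y.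

Let per (V : zmodType) (f : int -> int -> V) := forall x y : int,
  laplace f (x + (2 * L)%N) y = laplace f x y /\
  laplace f (x + N%:Z) (y + N%:Z) = laplace f x y.

Let A (j : nat) (u : int) : rat :=
  u%:~R / (Jlcm N L)%:R + eps (Jlcm N L) (((u - 1) %/ 2)%Z + (j * L)%N).
Let B (j : nat) (v : int) : rat :=
  v%:~R / N%:R + eps N (((v - 1) %/ 2)%Z + (j * L)%N).

Let epsD m (n : int) (k : nat) : eps m (n + (k * m)%N) = eps m n.
Proof. by rewrite /eps [n + _]addrC PoszM modzMDl. Qed.

Let epsDD m (n : int) (l k : nat) :
  eps m (n + (l + k * m)%N) = eps m (n + l).
Proof. by rewrite PoszD addrA epsD. Qed.

Let half2 (u : int) (k : nat) :
  ((u + (2 * k)%N - 1) %/ 2)%Z = ((u - 1) %/ 2)%Z + k.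
Proof.
have -> : u + (2 * k)%N - 1 = k%:Z * 2 + (u - 1).
  by rewrite PoszM; ring.
by rewrite divzMDl // addrC.
Qed.

Let GE (x y : int) :
  G N L x y = 2^-1 * \sum_(0 <= j < N %/ Fgcd N L) A j.+1 (x - y) * B j.+1 (x + y).
Proof. by rewrite /G big_add1. Qed.

Let G_split (c d : int) (x y : int) (f g : int -> rat) (k : rat) :
  (forall x y : int, G N L (x + c) (y + d) = G N L x y + f (x - y) + g (x + y) + k) ->
  laplace (G N L) (x + c) (y + d) = laplace (G N L) x y.
Proof.
move=> H; rewrite /laplace.
have -> : y + d - 1 = (y - 1) + d by ring.
have -> : y + d + 1 = (y + 1) + d by ring.
have -> : x + c - 1 = (x - 1) + c by ring.
have -> : x + c + 1 = (x + 1) + c by ring.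
rewrite !H.
have -> : x - 1 - y = x - (y + 1) by ring.
have -> : x + 1 - y = x - (y - 1) by ring.
have -> : x - 1 + y = x + (y - 1) by ring.
have -> : x + 1 + y = x + (y + 1) by ring.
ring.
Qed.

Let G_degenerate : (Jlcm N L = 0)%N -> forall x y, G N L x y = 0.
Proof.
move=> J0 x y; rewrite /G big1 ?mulr0 // => j _.
by rewrite /eps J0 invr0 !mulr0 addr0 mul0r.
Qed.

Let sum_rot (n : nat) (f : nat -> rat) : f n = f 0%N ->
  \sum_(0 <= j < n) f j.+1 = \sum_(0 <= j < n) f j.
Proof.
case: n => [|n] fn; first by rewrite !big_geq.
by rewrite big_nat_recr //= big_nat_recl //= fn addrC.
Qed.

Let per_G : per (G N L).
Proof.
move=> x y; have [J0|J_gt0] := posnP (Jlcm N L).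
  by rewrite /laplace !(G_degenerate J0).
have Arot j (u : int) : A j (u + (2 * L)%N) = A j.+1 u + (2 * L)%:R / (Jlcm N L)%:R.
  rewrite /A half2 rmorphD /= mulrDl addrAC.
  by congr (_ + eps _ _ + _); rewrite -addrA -PoszD mulSn.
have Brot j (u : int) : B j (u + (2 * L)%N) = B j.+1 u + (2 * L)%:R / N%:R.
  rewrite /B half2 rmorphD /= mulrDl addrAC.
  by congr (_ + eps _ _ + _); rewrite -addrA -PoszD mulSn.
have Bsh j (u : int) : B j (u + (2 * N)%N) = B j u + (2 * N)%:R / N%:R.
  rewrite /B half2 rmorphD /= mulrDl addrAC.
  congr (_ + _ + _); rewrite -(epsD N (((u - 1) %/ 2)%Z + (j * L)%N) 1) mul1n.
  by congr eps; ring.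
have JEl : Jlcm N L = (N %/ Fgcd N L * L)%N.
  by rewrite mulnC muln_divA // dvdn_gcdr.
have JEr : (N %/ Fgcd N L * L)%N = (L %/ Fgcd N L * N)%N.
  by rewrite -JEl /Jlcm divn_mulAC // dvdn_gcdl.
split.
- pose a : rat := (2 * L)%:R / (Jlcm N L)%:R; pose b : rat := (2 * L)%:R / N%:R.
  pose SA u := \sum_(0 <= j < N %/ Fgcd N L) A j.+2 u.
  pose SB v := \sum_(0 <= j < N %/ Fgcd N L) B j.+2 v.
  have H := @G_split (2 * L)%N%:Z 0 x y (fun u => 2^-1 * (b * SA u))
    (fun v => 2^-1 * (a * SB v))
    (2^-1 * \sum_(0 <= j < N %/ Fgcd N L) a * b).
  rewrite addr0 in H; apply: H => {}x {}y; rewrite addr0 !GE.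
  have -> : x + (2 * L)%N%:Z - y = x - y + (2 * L)%N%:Z by ring.
  have -> : x + (2 * L)%N%:Z + y = x + y + (2 * L)%N%:Z by ring.
  rewrite -[in RHS](@sum_rot _ (fun j => A j.+1 (x - y) * B j.+1 (x + y)));
      last first.
    rewrite /A /B !mulSn !mul0n !addn0; congr ((_ + _) * (_ + _)).
      by rewrite -[in LHS]JEl -[in RHS](epsDD _ _ _ 1) mul1n.
    by rewrite JEr epsDD.
  rewrite -!mulrDr; congr (_ * _); rewrite /SA /SB.
  rewrite !mulr_sumr -!big_split /=.
  by apply: eq_bigr => j _; rewrite Arot Brot -/a -/b; ring.
- pose b : rat := (2 * N)%:R / N%:R.
  pose SA u := \sum_(0 <= j < N %/ Fgcd N L) A j.+1 u.
  apply: (@G_split N%:Z N%:Z x y (fun u => 2^-1 * (b * SA u)) (fun=> 0) 0).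
  move=> {}x {}y; rewrite !GE !addr0.
  have -> : x + N%:Z - (y + N%:Z) = x - y by ring.
  have -> : x + N%:Z + (y + N%:Z) = x + y + (2 * N)%N%:Z by rewrite PoszM; ring.
  rewrite -!mulrDr; congr (_ * _); rewrite /SA.
  rewrite !mulr_sumr -!big_split /=.
  by apply: eq_bigr => j _; rewrite Bsh -/b; ring.
Qed.

Let state := int -> int -> R[i].

Let shift (k : R[i]) (a b : int) (s : state) : state :=
  fun x y => s x y + k * ratr (G N L (a - x) (b - y)).

Let per_shift k a b s : per s -> per (shift k a b s).
Proof.
have E (x y : int) : laplace (shift k a b s) x y =
    laplace s x y + k * ratr (laplace (G N L) (a - x) (b - y)).
  rewrite /shift /laplace.
  have -> : a - (x + 1) = a - x - 1 by ring.
  have -> : a - (x - 1) = a - x + 1 by ring.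
  have -> : b - (y + 1) = b - y - 1 by ring.
  have -> : b - (y - 1) = b - y + 1 by ring.
  by rewrite !(rmorphD, rmorphN) /=; ring.
move=> ps x y; rewrite !E; have [-> ->] := ps x y.
split; congr (_ + _ * ratr _).
- have [+ _] := per_G (a - (x + (2 * L)%N%:Z)) (b - y).
  have -> : a - (x + (2 * L)%N%:Z) + (2 * L)%N%:Z = a - x by ring.
  by move=> ->.
- have [_] := per_G (a - (x + N%:Z)) (b - (y + N%:Z)).
  have -> : a - (x + N%:Z) + N%:Z = a - x by ring.
  have -> : b - (y + N%:Z) + N%:Z = b - y by ring.
  by move=> ->.
Qed.

Fixpoint act (t : term) (f : state -> R[i]) (s : state) : R[i] :=
  match t with
  | Gen x y => if (2 %| x + y)%Z then f (shift 1 x y s) else cexp (h * s x y) * f s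
  | GenV x y => if (2 %| x + y)%Z then f (shift (-1) x y s) else cexp (- (h * s x y)) * f s
  | Scal k => k * f s
  | Add a b => act a f s + act b f s
  | Mul a b => act a (act b f) s
  end.

Let act_lin t k f g s :
  act t (fun s => k * f s + g s) s = k * act t f s + act t g s.
Proof.
elim: t f g s => [x y|x y|l|a IHa b IHb|a IHa b IHb] f g s /=.
- by case: ifP => // _; ring.
- by case: ifP => // _; ring.
- by ring.
- by rewrite IHa IHb; ring.
- by rewrite -IHa; congr (act a _ s); apply/funext => s'; rewrite IHb.
Qed.

Let act0 t s : act t (fun=> 0) s = 0.
Proof.
have := act_lin t (-1) (fun=> 0) (fun=> 0) s.
by rewrite mulr0 addr0 mulN1r addNr.
Qed.

Let act_per t f g : (forall s, per s -> f s = g s) ->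
  forall s, per s -> act t f s = act t g s.
Proof.
elim: t f g => [x y|x y|l|a IHa b IHb|a IHa b IHb] f g fg s ps /=.
- by case: ifP => _; rewrite fg //; exact: per_shift.
- by case: ifP => _; rewrite fg //; exact: per_shift.
- by rewrite fg.
- by rewrite (IHa _ _ fg) // (IHb _ _ fg).
- by apply: IHa => // s' ps'; exact: IHb.
Qed.

Let shiftC k a b k' a' b' s :
  shift k a b (shift k' a' b' s) = shift k' a' b' (shift k a b s).
Proof. by apply/funext => x; apply/funext => y; rewrite /shift addrAC. Qed.

Let shiftK k a b s : shift k a b (shift (- k) a b s) = s.
Proof.
by apply/funext => x; apply/funext => y; rewrite /shift mulNr subrK.
Qed.

Let par_pred (x : int) : (2 %| x - 1)%Z = ~~ (2 %| x)%Z.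
Proof. by lia. Qed.

Let par_succ (x : int) : (2 %| x + 1)%Z = ~~ (2 %| x)%Z.
Proof. by rewrite -{2}[x](addrK 1) par_pred negbK. Qed.

Let act_eta x y f s : act (eta_term x y) f s =
  if (2 %| x + y)%Z then cexp (h * laplace s x y) * f s
  else f (fun a b => s a b + ratr (laplace (G N L) (x - a) (y - b))).
Proof.
rewrite /=.
have -> : x + 1 + y = x + y + 1 by ring.
have -> : x - 1 + y = x + y - 1 by ring.
have -> : x + (y - 1) = x + y - 1 by ring.
have -> : x + (y + 1) = x + y + 1 by ring.
rewrite par_succ par_pred; case: (2 %| x + y)%Z => /=.
  rewrite !mulrA -!cexpD; congr (cexp _ * _); rewrite /laplace; ring.
congr f; apply/funext => a; apply/funext => b.
rewrite /shift /laplace.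
have -> : x + 1 - a = x - a + 1 by ring.
have -> : x - 1 - a = x - a - 1 by ring.
have -> : y + 1 - b = y - b + 1 by ring.
have -> : y - 1 - b = y - b - 1 by ring.
rewrite !rmorphD !rmorphN /=; ring.
Qed.

Let act_sound a b : teq a b ->
  forall f s, per s -> act a f s = act b f s.
Proof.
elim=> {a b} //=.
- by move=> a b _ IH f s ps; rewrite IH.
- by move=> a b c _ IH1 _ IH2 f s ps; rewrite IH1 // IH2.
- by move=> a a' b b' _ IHa _ IHb f s ps; rewrite IHa // IHb.
- move=> a a' b b' _ IHa _ IHb f s ps; rewrite IHa //.
  by apply: act_per => // s' ps'; exact: IHb.
- by move=> a b c f s ps; rewrite addrA.
- by move=> a b f s ps; rewrite addrC.
- by move=> a f s ps; rewrite mul0r add0r.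
- by move=> a f s ps; ring.
- by move=> a f s ps; rewrite mul1r.
- move=> a b c f s ps.
  have /esym := act_lin a 1 (act b f) (act c f) s; rewrite [1 * act a _ _]mul1r => ->.
  by congr (act a _ s); apply/funext => s'; rewrite mul1r.
- by move=> k l f s ps; rewrite mulrDl.
- by move=> k l f s ps; rewrite mulrA.
- move=> k a f s ps.
  have /esym := act_lin a k f (fun=> 0) s; rewrite act0 addr0 => ->.
  by congr (act a _ s); apply/funext => s'; rewrite addr0.
- move=> x y f s ps; case: (2 %| x + y)%Z; last by rewrite mulrA cexpN.
  by rewrite mul1r shiftC shiftK.
- move=> x y f s ps; case: (2 %| x + y)%Z; last by rewrite mulrA [X in X * _]mulrC cexpN.
  by rewrite mul1r shiftK.
- move=> x y x' y' xy f s ps; rewrite xy; case: (2 %| x' + y')%Z; last by ring.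
  by rewrite shiftC.
- move=> x y x' y' -> /negPf -> f s ps; rewrite /qpow mulrA -cexpD.
  by congr (cexp _ * _); rewrite /shift mul1r mulrDr addrC.
- move=> x y f s ps; have [e _] := ps x y.
  rewrite -[LHS]/(act (eta_term (x + (2 * L)%N%:Z) y) f s).
  rewrite -[RHS]/(act (eta_term x y) f s) !act_eta e.
  have -> : (2 %| x + (2 * L)%N%:Z + y)%Z = (2 %| x + y)%Z by lia.
  case: ifP => // _; congr f; apply/funext => u; apply/funext => v.
  have [+ _] := per_G (x - u) (y - v).
  have -> : x - u + (2 * L)%N%:Z = x + (2 * L)%N%:Z - u by ring.
  by move=> ->.
- move=> x y f s ps; have [_ e] := ps x y.
  rewrite -[LHS]/(act (eta_term (x + N%:Z) (y + N%:Z)) f s).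
  rewrite -[RHS]/(act (eta_term x y) f s) !act_eta e.
  have -> : (2 %| x + N%:Z + (y + N%:Z))%Z = (2 %| x + y)%Z by lia.
  case: ifP => // _; congr f; apply/funext => u; apply/funext => v.
  have [_] := per_G (x - u) (y - v).
  have -> : x - u + N%:Z = x + N%:Z - u by ring.
  have -> : y - v + N%:Z = y + N%:Z - v by ring.
  by move=> ->.
Qed.

Lemma Tq_nontrivial : cls (Scal 1) != cls (Scal 0).
Proof.
apply/eqP => /clsP /act_sound /(_ (fun=> 1) (fun _ _ => 0)) /=.
have p0 : per (fun _ _ : int => 0 : R[i]) by rewrite /per /laplace !addr0.
by move=> /(_ p0)/eqP; rewrite mulr1 mul0r oner_eq0.
Qed.

End Nontrivial.

HB.instance Definition _ := GRing.Zmodule_isNzRing.Build Tq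
  TmulA Tmul1 Tmulr1 TmulDl TmulDr Tq_nontrivial.

Lemma clsD a b : cls a + cls b = cls (Add a b). Proof. exact: TaddE. Qed.
Lemma clsM a b : cls a * cls b = cls (Mul a b). Proof. exact: TmulE. Qed.

Lemma TscaleA k l u : Tscale k (Tscale l u) = Tscale (k * l) u.
Proof.
rewrite -(repK u) !TscaleE; apply/clsP.
apply: teq_trans (teq_mulA _ _ _) _.
by apply: teq_mul; [exact/teq_sym/teq_scalM|exact: teq_refl].
Qed.

Lemma Tscale1 : left_id 1 Tscale.
Proof. by move=> u; rewrite -(repK u) TscaleE; apply/clsP; exact: teq_mul1. Qed.

Lemma TscaleDr : right_distributive Tscale +%R.
Proof.
move=> k u v; rewrite -(repK u) -(repK v) clsD !TscaleE clsD.
by apply/clsP; exact: teq_mulDr.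
Qed.

Lemma TscaleDl u : {morph Tscale^~ u : k l / k + l}.
Proof.
move=> k l; rewrite -(repK u) !TscaleE clsD; apply/clsP.
apply: teq_trans (teq_mulDl _ _ _).
by apply: teq_mul; [exact: teq_scalD|exact: teq_refl].
Qed.

HB.instance Definition _ := GRing.Zmodule_isLmodule.Build R[i] Tq
  TscaleA Tscale1 TscaleDr TscaleDl.

Lemma clsZ k a : k *: cls a = cls (Mul (Scal k) a).
Proof. exact: TscaleE. Qed.

Lemma TscaleAl k (u v : Tq) : k *: (u * v) = (k *: u) * v.
Proof.
rewrite -(repK u) -(repK v) !(clsM, clsZ).
by apply/clsP; exact: teq_mulA.
Qed.

HB.instance Definition _ := GRing.Lmodule_isLalgebra.Build R[i] Tq TscaleAl.

Lemma TscaleAr k (u v : Tq) : k *: (u * v) = u * (k *: v).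
Proof.
rewrite -(repK u) -(repK v) !(clsM, clsZ); apply/clsP.
apply: teq_trans (teq_mulA _ _ _) _; apply: teq_trans _ (teq_sym (teq_mulA _ _ _)).
by apply: teq_mul; [exact: teq_scalC|exact: teq_refl].
Qed.

HB.instance Definition _ := GRing.Lalgebra_isAlgebra.Build R[i] Tq TscaleAr.

Definition tau (x y : int) : Tq := cls (Gen x y).
Definition tauV (x y : int) : Tq := cls (GenV x y).

Definition eta (x y : int) : Tq :=
  tauV (x + 1) y * tauV (x - 1) y * (tau x (y - 1) * tau x (y + 1)).

Lemma tauVr x y : tau x y * tauV x y = 1.
Proof. by rewrite clsM; apply/clsP; exact: teq_genV. Qed.

Lemma tauVl x y : tauV x y * tau x y = 1.
Proof. by rewrite clsM; apply/clsP; exact: teq_Vgen. Qed.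

Lemma tau_comm (x y x' y' : int) : (2 %| x + y)%Z = (2 %| x' + y')%Z ->
  tau x y * tau x' y' = tau x' y' * tau x y.
Proof. by move=> e; rewrite !clsM; apply/clsP; exact: teq_comm. Qed.

Lemma tau_qcomm (x y x' y' : int) : (2 %| x + y)%Z -> ~~ (2 %| x' + y')%Z ->
  tau x y * tau x' y' =
  qpow h (G N L (x - x') (y - y')) *: (tau x' y' * tau x y).
Proof.
move=> e o; rewrite !clsM clsZ.
by apply/clsP; exact: teq_qcomm.
Qed.

Lemma eta_periodic (x y : int) :
  eta (x + (2 * L)%N%:Z) y = eta x y /\ eta (x + N%:Z) (y + N%:Z) = eta x y.
Proof.
have E (a b : int) : eta a b = cls (eta_term a b) by rewrite /eta /eta_term -!clsM.
by rewrite !E; split; apply/clsP; [exact: teq_eta2L|exact: teq_etaN].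
Qed.

Section Universal.
Variables (A : algType R[i]) (a aV : int -> int -> A).
Hypotheses (aVr : forall x y, a x y * aV x y = 1)
  (aVl : forall x y, aV x y * a x y = 1)
  (a_comm : forall x y x' y' : int, (2 %| x + y)%Z = (2 %| x' + y')%Z ->
     a x y * a x' y' = a x' y' * a x y)
  (a_qcomm : forall x y x' y' : int, (2 %| x + y)%Z -> ~~ (2 %| x' + y')%Z ->
     a x y * a x' y' = qpow h (G N L (x - x') (y - y')) *: (a x' y' * a x y)).
Let etaA (x y : int) : A :=
  aV (x + 1) y * aV (x - 1) y * (a x (y - 1) * a x (y + 1)).
Hypotheses
  (a_eta2L : forall x y : int, etaA (x + (2 * L)%N%:Z) y = etaA x y)
  (a_etaN : forall x y : int, etaA (x + N%:Z) (y + N%:Z) = etaA x y).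

Fixpoint teval (t : term) : A :=
  match t with
  | Gen x y => a x y
  | GenV x y => aV x y
  | Scal k => k%:A
  | Add b c => teval b + teval c
  | Mul b c => teval b * teval c
  end.

Lemma teval_teq b c : teq b c -> teval b = teval c.
Proof.
elim=> {b c} /=.
- by [].
- by [].
- by move=> b c d _ -> _ ->.
- by move=> b b' c c' _ -> _ ->.
- by move=> b b' c c' _ -> _ ->.
- by move=> *; rewrite addrA.
- by move=> *; rewrite addrC.
- by move=> *; rewrite scale0r add0r.
- by move=> *; rewrite scaleN1r mulN1r addNr scale0r.
- by move=> *; rewrite mulrA.
- by move=> *; rewrite scale1r mul1r.
- by move=> *; rewrite mulrDl.
- by move=> *; rewrite mulrDr.
- by move=> *; rewrite scalerDl.
- by move=> *; rewrite mulr_algl scalerA.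
- by move=> *; rewrite mulr_algl mulr_algr.
- by move=> *; rewrite scale1r.
- by move=> *; rewrite scale1r.
- by move=> *; exact: a_comm.
- by move=> *; rewrite mulr_algl; exact: a_qcomm.
- by move=> *; exact: a_eta2L.
- by move=> *; exact: a_etaN.
Qed.

Theorem Tq_universal :
  exists f : {lrmorphism Tq -> A}, forall x y, f (tau x y) = a x y.
Proof.
pose f (u : Tq) : A := teval (rep u).
have fE t : f (cls t) = teval t by apply/teval_teq/rep_cls.
have fB : zmod_morphism f.
  move=> u v; rewrite -(repK u) -(repK v) -scaleN1r clsZ clsD.
  by rewrite !fE /= scaleN1r mulN1r.
have fM : monoid_morphism f.
  split; first by rewrite [1]/(cls _) fE /= scale1r.
  by move=> u v; rewrite -(repK u) -(repK v) clsM !fE.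
have fZ : scalable f.
  by move=> k u; rewrite -(repK u) clsZ !fE /= mulr_algl.
pose f1 := GRing.isZmodMorphism.Build _ _ f fB.
pose f2 := GRing.isMonoidMorphism.Build _ _ f fM.
pose f3 := GRing.isScalable.Build _ _ _ _ f fZ.
pose F : {lrmorphism Tq -> A} := HB.pack f f1 f2 f3.
by exists F => x y; rewrite /F /= /tau fE.
Qed.

End Universal.
End Algebra.

Record algAut (K : comNzRingType) (D : algType K) := AlgAut {
  aut_fun :> {lrmorphism D -> D};
  aut_inv : D -> D;
  aut_funK : cancel aut_fun aut_inv;
  aut_invK : cancel aut_inv aut_fun
}.

Section Automorphisms.
Variables (K : comNzRingType) (D : algType K).

Definition aut_comp (f g : algAut D) : algAut D :=
  @AlgAut K D (aut_fun f \o aut_fun g) (aut_inv g \o aut_inv f)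
    (can_comp (aut_funK f) (aut_funK g)) (can_comp (aut_invK g) (aut_invK f)).

Definition aut_pow (f : algAut D) (n : int) : D -> D :=
  match n with
  | Posz m => iter m f
  | Negz m => iter m.+1 (aut_inv f)
  end.

End Automorphisms.

Section Evolution.
Variables (R : realType) (N L : nat) (h : R[i]).
Variables (D : algType R[i]) (iota : {lrmorphism Tq N L h -> D}).

Let t_ (x y : int) : D := iota (tau N L h x y).
Let tV_ (x y : int) : D := iota (tauV N L h x y).

(* D stands for a completion of Tq (for instance its division ring of
   fractions), iota for the embedding.
   s = 1 gives the formulas of kappa_+ and s = -1 those of kappa_-. *)
Definition kappa_on_generators (s : int) (f : D -> D) : Prop :=
  forall x y : int,
    ((2 %| x + y)%Z -> f (t_ (x - s) y) = t_ x y) /\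
    (~~ (2 %| x + y)%Z ->
      f (t_ (x - s) y) =
      - (t_ (x + 1) y * t_ (x - 1) y + t_ x (y + 1) * t_ x (y - 1)) * tV_ x y).

(* tau(2t, x, y) and tau(2t-1, x, y); only meaningful for t + x + y even. *)
Definition tau3 (kappa : algAut D) (t x y : int) : D :=
  if (2 %| t)%Z then aut_pow kappa (t %/ 2)%Z (t_ x y)
  else aut_pow kappa ((t + 1) %/ 2)%Z (t_ x y).

End Evolution.

(* Main.v *)
(* The automorphism [kappap] translates the whole solution along (1, 1, 0):
   kappap (T t x y) = T (t + 1) (x + 1) y.  All the relations are invariant
   under this translation, so they only need to be checked at t = 0, where they
   are the relations of T_q(N, L) and the formula for
   kappap (kappam (tau x y)) = kappap (tau (x - 1) y). *)
Require Import Defs.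
From mathcomp Require Import all_boot all_order all_algebra.
From mathcomp Require Import complex.
From mathcomp Require Import reals.
From mathcomp Require Import zify.
Import Order.TTheory GRing.Theory Num.Theory.
Local Open Scope ring_scope.
Local Open Scope complex_scope.

(** Each diagonal in direction (1, 1) meets the line [t = 0] in one point; as [step] is an
    equivalence, the property spreads from there both ways. *)
Lemma int_diagonal_ind (P : int -> int -> Prop) :
  (forall t x : int, P t x <-> P (t + 1) (x + 1)) ->
  (forall x, P 0 x) -> forall t x, P t x.
Proof.
move=> step P0; elim/int_ind => [//|n IH x|n IH x].
- have := (step n%:Z (x - 1)).1 (IH _); rewrite subrK.
  by have -> : n%:Z + 1 = n.+1%:Z by lia.
- apply/step; have -> : - n.+1%:Z + 1 = - n%:Z by lia.
  exact: IH.
Qed.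

Section AutomorphismPowers.
Variables (K : comNzRingType) (D : algType K).
Implicit Types (f g : algAut D) (n : int) (d : D).

Lemma aut_inj f : injective f.
Proof. exact: can_inj (aut_funK f). Qed.

Lemma aut_powS f n d : aut_pow f (n + 1) d = aut_pow f n (f d).
Proof.
case: n => [n|n]; first by rewrite -PoszD addn1; exact: iterSr.
have -> : aut_pow f (Negz n) (f d) = iter n (aut_inv f) d.
  by rewrite /aut_pow iterSr aut_funK.
(* [Negz n] is -(n + 1), so for [n = 0] the exponent on the left becomes 0 and both sides are
   [d]. *)
by case: n => // n; have -> : Negz n.+1 + 1 = Negz n by lia.
Qed.

Lemma aut_pow_comm f g n d :
  (forall d, g (f d) = f (g d)) -> g (aut_pow f n d) = aut_pow f n (g d).
Proof.
(* Negative powers iterate [aut_inv f], so [g] has to commute with it too. *)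
move=> gf; have gfV c : g (aut_inv f c) = aut_inv f (g c).
  by apply: (aut_inj f); rewrite -gf !aut_invK.
case: n => n; rewrite /aut_pow; first by elim: n => //= n <-.
by elim: n.+1 => //= m <-.
Qed.

End AutomorphismPowers.

Arguments aut_inj {K D} f [x1 x2].

Section Translation.
Variables (R : realType) (N L : nat) (h : R[i]).
Variables (D : algType R[i]) (iota : {lrmorphism Tq N L h -> D}).
Variables (kappap kappam : algAut D).
Hypotheses (kappapE : kappa_on_generators iota 1 kappap)
  (kappamE : kappa_on_generators iota (-1) kappam)
  (kappaC : forall d : D, kappap (kappam d) = kappam (kappap d)).

Local Notation T := (tau3 iota (aut_comp kappap kappam)).
Local Notation t_ x y := (iota (tau N L h x y)).

Lemma kappap_odd (x y : int) : ~~ (2 %| x + y)%Z ->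
  kappap (t_ x y) = t_ (x + 1) y.
Proof.
by move=> o; have := (kappapE (x + 1) y).1; rewrite addrK; apply; lia.
Qed.

Lemma kappam_odd (x y : int) : ~~ (2 %| x + y)%Z ->
  kappam (t_ x y) = t_ (x - 1) y.
Proof.
by move=> o; have := (kappamE (x - 1) y).1; rewrite opprK subrK; apply; lia.
Qed.

(** For odd [t] the exponent stays the same and [kappap] shifts the odd generator. For even [t] it
    grows by one: the extra [kappap] after [kappam] sends tau(x + 1, y) to [kappap] of tau(x, y),
    since [kappam] moves the odd generator back. *)
Lemma kappap_tau3 (t x y : int) : (2 %| t + x + y)%Z ->
  kappap (T t x y) = T (t + 1) (x + 1) y.
Proof.
move=> e; rewrite /tau3; case: ifPn => t2.
  rewrite ifN; last by lia.
  have -> : ((t + 1 + 1) %/ 2)%Z = (t %/ 2)%Z + 1 by lia.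
  rewrite aut_powS aut_pow_comm /=; last by move=> d; rewrite /= kappaC.
  by rewrite kappam_odd ?addrK //; lia.
rewrite ifT; last by lia.
rewrite aut_pow_comm; last by move=> d; rewrite /= kappaC.
by rewrite kappap_odd //; lia.
Qed.

Lemma tau3_0 (x y : int) : T 0 x y = t_ x y.
Proof. by []. Qed.

(** The exponent (-1 + 1) / 2 vanishes as it does at time 0, so these two layers are the initial
    data: even generators at time 0, odd ones at time -1. *)
Lemma tau3_N1 (x y : int) : T (-1) x y = t_ x y.
Proof. by []. Qed.

Lemma tau3_bilinear (t x y : int) : ~~ (2 %| t + x + y)%Z ->
  T (t + 1) x y * T (t - 1) x y
  + T t (x + 1) y * T t (x - 1) y
  + T t x (y + 1) * T t x (y - 1) = 0.
Proof.
move: t x; apply: int_diagonal_ind => [t x|x o].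
  have -> : (2 %| t + 1 + (x + 1) + y)%Z = (2 %| t + x + y)%Z by lia.
  (* One implication follows because [kappap] preserves 0, the other because it is injective. *)
  suff E : ~~ (2 %| t + x + y)%Z ->
      kappap (T (t + 1) x y * T (t - 1) x y
              + T t (x + 1) y * T t (x - 1) y
              + T t x (y + 1) * T t x (y - 1)) =
      T (t + 1 + 1) (x + 1) y * T (t + 1 - 1) (x + 1) y
      + T (t + 1) (x + 1 + 1) y * T (t + 1) (x + 1 - 1) y
      + T (t + 1) (x + 1) (y + 1) * T (t + 1) (x + 1) (y - 1).
    split=> H o; first by rewrite -E // H // rmorph0.
    by apply: (aut_inj kappap); rewrite E // H // rmorph0.
  move=> o; rewrite !rmorphD !rmorphM /= !kappap_tau3; try lia.
  by rewrite ![_ + 1 - 1]addrAC.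
(* Here [x + y] is odd, so (0, x - 1, y) has the right parity and its translate is the value given
   by the second clause of [kappapE]. *)
have -> : T (0 + 1) x y = kappap (t_ (x - 1) y).
  by rewrite -tau3_0 kappap_tau3 ?subrK //; lia.
have tauVK : iota (tauV N L h x y) * t_ x y = 1.
  by rewrite -rmorphM tauVl rmorph1.
have /= -> := (kappapE x y).2; last by lia.
(* The factor at time -1 is tau(x, y), which cancels the inverse ending that value. *)
by rewrite sub0r tau3_N1 !tau3_0 -mulrA tauVK mulr1 -addrA addNr.
Qed.

Lemma tau3_qcomm (t x y x' y' : int) :
  (2 %| t + x + y)%Z -> (2 %| (t - 1) + x' + y')%Z ->
  T t x y * T (t - 1) x' y' =
  qpow h (G N L (x - x') (y - y')) *: (T (t - 1) x' y' * T t x y).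
Proof.
(* With [x' = x - d] the argument of [G] is constant along the diagonal. *)
rewrite -[x'](subKr x); move: (x - x') => d; rewrite subKr.
move: t x; apply: int_diagonal_ind => [t x|x e o].
  have -> : (2 %| t + 1 + (x + 1) + y)%Z = (2 %| t + x + y)%Z by lia.
  have -> : (2 %| t + 1 - 1 + (x + 1 - d) + y')%Z =
    (2 %| t - 1 + (x - d) + y')%Z by lia.
  suff E : (2 %| t + x + y)%Z -> (2 %| (t - 1) + (x - d) + y')%Z ->
      kappap (T t x y) = T (t + 1) (x + 1) y /\
      kappap (T (t - 1) (x - d) y') = T (t + 1 - 1) (x + 1 - d) y'.
    split=> H e e'; have [E1 E2] := E e e'.
      by rewrite -E1 -E2 -!rmorphM -linearZ /= H.
    apply: (aut_inj kappap).
    by rewrite linearZ /= !rmorphM /= E1 E2 H.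
  move=> e e'; rewrite !kappap_tau3 //.
  by rewrite ![_ + 1 - _]addrAC.
rewrite sub0r tau3_N1 !tau3_0 -!rmorphM tau_qcomm; [|lia..].
by rewrite subKr; exact: linearZ.
Qed.

Lemma tau3_comm (t x y x' y' : int) :
  (2 %| t + x + y)%Z -> (2 %| t + x' + y')%Z ->
  T t x y * T t x' y' = T t x' y' * T t x y.
Proof.
rewrite -[x'](subKr x); move: (x - x') => d.
move: t x; apply: int_diagonal_ind => [t x|x e e'].
  have -> : (2 %| t + 1 + (x + 1) + y)%Z = (2 %| t + x + y)%Z by lia.
  have -> : (2 %| t + 1 + (x + 1 - d) + y')%Z =
    (2 %| t + (x - d) + y')%Z by lia.
  rewrite [x + 1 - d]addrAC; split=> H e e'.
    by rewrite -!kappap_tau3 // -!rmorphM /= H.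
  by apply: (aut_inj kappap); rewrite !rmorphM /= !kappap_tau3 // H.
(* At time 0 both generators are even. *)
by rewrite !tau3_0 -!rmorphM tau_comm //; lia.
Qed.

End Translation.

Theorem proposition10 (R : realType) (N L : nat)
    (N_gt0 : (0 < N)%N) (L_gt0 : (0 < L)%N)
    (q h : R[i]) (q_neq0 : q != 0) (h_log : cexp h = q)
    (D : algType R[i]) (iota : {lrmorphism Tq N L h -> D})
    (iota_inj : injective iota)
    (kappap kappam : algAut D)
    (kappapE : kappa_on_generators iota 1 kappap)
    (kappamE : kappa_on_generators iota (-1) kappam)
    (kappaC : forall d : D, kappap (kappam d) = kappam (kappap d)) :
  let T := tau3 iota (aut_comp kappap kappam) in
  [/\ forall t x y : int, ~~ (2 %| t + x + y)%Z ->
        T (t + 1) x y * T (t - 1) x y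
        + T t (x + 1) y * T t (x - 1) y
        + T t x (y + 1) * T t x (y - 1) = 0,
      forall t x y x' y' : int,
        (2 %| t + x + y)%Z -> (2 %| (t - 1) + x' + y')%Z ->
        T t x y * T (t - 1) x' y' =
        qpow h (G N L (x - x') (y - y')) *: (T (t - 1) x' y' * T t x y)
    & forall t x y x' y' : int,
        (2 %| t + x + y)%Z -> (2 %| t + x' + y')%Z ->
        T t x y * T t x' y' = T t x' y' * T t x y].
Proof.
split.
- exact: tau3_bilinear.
- exact: tau3_qcomm.
- exact: tau3_comm.
Qed.
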